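(* Let $\mathfrak{n}$ be the nilradical of a Borel subalgebra of the simple Lie algebra of type $F_4$ over a finite field $\mathbb{F}_q$ of sufficiently large characteristic, and let $S\subset\mathfrak{n}^*$ be the set of linear forms $\lambda$ such that $\operatorname{rk}A_{\lambda,\gamma}=\operatorname{rk}B_{\lambda,\gamma}$ for every $\gamma\in\operatorname{supp}(\lambda)$ (notation in the context). Write $\lambda=\sum_{\alpha\in\Phi^+}\lambda_\alpha e_\alpha^*$. Then $S$ consists exactly of (i) all linear forms whose support belongs to the list $\mathcal{L}$ of 880 supports given in the context; and (ii) the linear forms with one of the three supports $$\{\alpha_1+\alpha_2+2\alpha_3,\ \alpha_1+\alpha_2,\ \alpha_2+2\alpha_3+\alpha_4,\ \alpha_2+\alpha_3+\alpha_4,\ \alpha_2\},$$ $$\{\alpha_1+\alpha_2+2\alpha_3,\ \alpha_1+\alpha_2,\ \alpha_2+2\alpha_3+\alpha_4,\ \alpha_2+\alpha_3+\alpha_4,\ \alpha_2,\ \alpha_4\},$$ $$\{\alpha_1+\alpha_2+2\alpha_3,\ \alpha_1+\alpha_2,\ \alpha_2+2\alpha_3+\alpha_4,\ \alpha_2+\alpha_3+\alpha_4,\ \alpha_4\}$$ whose coordinates satisfy $$\lambda_{\alpha_1+\alpha_2}\,\lambda_{\alpha_2+2\alpha_3+\alpha_4}^2=\lambda_{\alpha_1+\alpha_2+2\alpha_3}\,\lambda_{\alpha_2+\alpha_3+\alpha_4}^2.$$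
   Context: Let $\mathfrak{g}$ be the simple Lie algebra of type $\Phi=F_4$ over $\mathbb{F}_q$ (characteristic sufficiently large), $\Phi^+$ the positive roots for a Borel subalgebra $\mathfrak{b}$, $\mathfrak{n}$ the nilradical of $\mathfrak{b}$, with basis of root vectors $\{e_\alpha,\ \alpha\in\Phi^+\}$, and dual basis $\{e_\alpha^*\}$ of $\mathfrak{n}^*$. Simple roots: $\alpha_1=\varepsilon_2-\varepsilon_3$, $\alpha_2=\varepsilon_3-\varepsilon_4$, $\alpha_3=\varepsilon_4$, $\alpha_4=\frac12(\varepsilon_1-\varepsilon_2-\varepsilon_3-\varepsilon_4)$ with $\varepsilon_i$ the standard basis of $\mathbb{R}^4$. The linear order $\succ$ on $\Phi^+$ is lexicographic: $\sum a_i\alpha_i\succ\sum b_i\alpha_i$ if $a_i>b_i$ for the smallest $i$ with $a_i\neq b_i$. Normalization of root vectors (only these constants matter for the displayed equation): $[e_{\alpha_2},e_{\alpha_1}]=e_{\alpha_1+\alpha_2}$, $[e_{\alpha_2+2\alpha_3},e_{\alpha_1}]=e_{\alpha_1+\alpha_2+2\alpha_3}$, $[e_{\alpha_4},e_{\alpha_2+\alpha_3}]=e_{\alpha_2+\alpha_3+\alpha_4}$, $[e_{\alpha_3+\alpha_4},e_{\alpha_2}]=e_{\alpha_2+\alpha_3+\alpha_4}$, $[e_{\alpha_4},e_{\alpha_2+2\alpha_3}]=e_{\alpha_2+2\alpha_3+\alpha_4}$, $[e_{\alpha_3+\alpha_4},e_{\alpha_2+\alpha_3}]=-e_{\alpha_2+2\alpha_3+\alpha_4}$.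 The support of $\lambda$ is $\operatorname{supp}(\lambda)=\{\alpha\in\Phi^+:\lambda(e_\alpha)\ne0\}$. For $\lambda\in\mathfrak{n}^*$, $\gamma\in\Phi^+$: $$A_{\lambda,\gamma}=(\lambda([e_\alpha,e_\beta]))_{\alpha\succeq\gamma;\ \beta\in\Phi^+},\qquad B_{\lambda,\gamma}=(\lambda([e_\alpha,e_\beta]))_{\alpha\succ\gamma;\ \beta\in\Phi^+}$$ (rows indexed by $\alpha\in\Phi^+$, columns by $\beta\in\Phi^+$; an empty matrix has rank $0$). The list $\mathcal{L}$. Denote the 24 positive roots by letters, in increasing lexicographic order: $a=\alpha_4$, $b=\alpha_3$, $c=\alpha_3+\alpha_4$, $d=\alpha_2$, $e=\alpha_2+\alpha_3$, $f=\alpha_2+\alpha_3+\alpha_4$, $g=\alpha_2+2\alpha_3$, $h=\alpha_2+2\alpha_3+\alpha_4$, $i=\alpha_2+2\alpha_3+2\alpha_4$, $j=\alpha_1$, $k=\alpha_1+\alpha_2$, $l=\alpha_1+\alpha_2+\alpha_3$, $m=\alpha_1+\alpha_2+\alpha_3+\alpha_4$, $n=\alpha_1+\alpha_2+2\alpha_3$, $o=\alpha_1+\alpha_2+2\alpha_3+\alpha_4$, $p=\alpha_1+\alpha_2+2\alpha_3+2\alpha_4$, $q=\alpha_1+2\alpha_2+2\alpha_3$, $r=\alpha_1+2\alpha_2+2\alpha_3+\alpha_4$, $s=\alpha_1+2\alpha_2+2\alpha_3+2\alpha_4$, $t=\alpha_1+2\alpha_2+3\alpha_3+\alpha_4$,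 $u=\alpha_1+2\alpha_2+3\alpha_3+2\alpha_4$, $v=\alpha_1+2\alpha_2+4\alpha_3+2\alpha_4$, $w=\alpha_1+3\alpha_2+4\alpha_3+2\alpha_4$, $x=2\alpha_1+3\alpha_2+4\alpha_3+2\alpha_4$. (In the list below the letters stand for these roots only.) A word such as $gfa$ stands for the set $\{g,f,a\}$; $0$ stands for the empty set. For a word $P$: $P[w_1,w_2,\dots]$ denotes the collection of sets $P\cup w_1,\ P\cup w_2,\dots$; and $P\langle z_1,\dots,z_r\rangle$ denotes the collection of the $2^r$ sets $P\cup Z$, $Z\subseteq\{z_1,\dots,z_r\}$. The list $\mathcal{L}$ is the union of the following collections. Let $\mathcal{E}$ be the collection of 35 sets: $0$, $a$, $b$, $ba$, $c$, $d$, $dc$, $db$, $dba$, $da$, $e$, $ec$, $eca$, $ea$, $f$, $fb$, $g$, $gf$, $gfa$, $gd$, $gdc$, $gdca$, $gda$, $gc$, $gca$, $ga$, $h$, $hd$, $i$, $ig$, $igd$, $ie$, $id$, $idb$, $ib$. 1. (105 supports) $\mathcal{E}$; $j[\mathcal{E}]$; $x[\mathcal{E}]$. 2. Largest root $k$ (28): $k[0,i,ig,ie,ieb,ib,h,g,gf,gfc,gfca,gfa,gc,gca,ga,f,fc,fcb,fb,e,ec,eb,eba,ea,c,b,ba,a]$. 3. Largest root $l$ (29): $l[0,i,ig,igd,id,h,hf,hd,hdc,hc,g,gf,gfa,gd,gdc,gdca,gda,gc,gca,ga,f,fa,d,dc,dca,da,c,ca,a]$. 4. Largest root $m$ (28):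 $m[0,i,ih,ihg,ihgd,ihe,ihd,ihdb,ihb,ig,igd,ie,id,idb,ib,h,hg,hgd,he,hd,hdb,hb,g,gd,e,d,db,b]$. 5. Largest root $n$ (68): $nm[0,i,if,ife,ifed,ifd,ie,ied,id,h,he,hed,hd,f,fd,e,d,da,a]$; $nk\langle e,d,c,a\rangle$; $nki\langle e,d\rangle$; $nk[h,hf,f]$; $n\langle e,d,c,a\rangle$; $ni\langle e,d\rangle$; $n[h,hf,hd,hda,ha,f]$. 6. Largest root $o$ (64): $o\langle k,i,g,f,e,d\rangle$. 7. Largest root $p$ (140): $pnk\langle h,g,f,e,d\rangle$; $pn\langle h,g,f,e,d\rangle$; $pl\langle h,g,f,e,d\rangle$; and, with $\mathcal{F}$ the collection $0,h,hg,hge,hged,hgd,he,hed,hd,g,gf,gfd,gd,f,fe,fd,fdb,fb,e,d,db,b$: $pk[\mathcal{F}]$; $p[\mathcal{F}]$. 8. Largest root $q$ (55): $q[0,p,ph,pf,pfb,pb]$; $qo[0,i,ia,f,c,ca,a]$; $qm[0,i,ic,icb,ib,h,hb,c,b,ba,a]$; $qj[0,i,ib,h,hc,hca,ha,f,fc,fb,fba,fa,c,b,ba,a]$; $q[i,ib,h,hc,hca,ha,f,fc,fb,fba,fa,c,b,ba,a]$. 9. Largest root $r$ (47): $rp[0,n,ng,nc,ncb,nb,g,c,cb,b]$; $rn[0,i,c,cb,b]$; $r\langle j,i,g,c,b\rangle$. 10. Largest root $s$ (106): $sqo[0,n,ng,nc,ncb,nb,g,c,cb,b]$; $sqn[0,h,c,cb,b]$;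 $sq\langle j,h,g,c,b\rangle$; $so[0,n,ng,ne,neb,nb,g,e,eb,b]$; $sn[0,h,e,ec,c]$; $sl\langle h,g,c,b\rangle$; $sj[0,h,hg,hgb,hb,g,gc,e,ec,ecb,eb,c,cb,b]$; $s[0,h,hg,hgb,hb,g,gc,e,ec,ecb,eb,c,cb,b]$. 11. Largest root $t$ (32): $ts\langle j,a\rangle$; $tp\langle k,d,a\rangle$; $tk\langle i,a\rangle$; $t\langle j,i,d,a\rangle$. 12. Largest root $u$ (16): $u[0,q,qj,n,nk,nkd,nd,k,kg,j,jg,jgd,jd,g,gd,d]$. 13. Largest root $v$ (92): $v$; $vsq\langle j\rangle$; $vsl\langle k,d\rangle$; $vsk\langle e\rangle$; $vs\langle j,e,d\rangle$; $vr\langle j\rangle$; $vqm\langle k,d,a\rangle$; $vqk\langle f,a\rangle$; $vq\langle j,f,d,a\rangle$; $vm\langle k,e,d\rangle$; $vl[0,k,kf,kd,kda,ka,f,fd,fda,fa,d,da,a]$; $vk[0,f,e,ea,a]$; $vj[0,f,fd,e,ed,eda,ea,d,da,a]$; $v[f,fd,e,ed,eda,ea,d,da,a]$. 14. Largest root $w$ (70): $wpn\langle k,j\rangle$; $wpl\langle j\rangle$; $wp\langle k,j,b\rangle$; $wo\langle k,j\rangle$; $wnm\langle j,a\rangle$; $wnk\langle j,c,a\rangle$; $wn\langle j,c,a\rangle$; $wm\langle j,b\rangle$; $wl\langle j,c,a\rangle$; $wkj[0,c,b,ba,a]$; $wk[0,c,b,ba,a]$; $wj[0,c,b,ba,a]$;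 $w[0,c,b,ba,a]$. *)

(* Defs.v *)
From Stdlib Require Import Ascii String.
From HB Require Import structures.
From mathcomp Require Import all_boot all_order all_algebra.
Set Implicit Arguments.
Unset Strict Implicit.
Unset Printing Implicit Defensive.
Import Order.TTheory GRing.Theory Num.Theory.
Local Open Scope ring_scope.

HB.mixin Record isLie (F : fieldType) (g : Type) of Vector F g := {
  lie : g -> g -> g;
  lie_linearl : forall (a : F) (x y z : g),
    lie (a *: x + y) z = a *: lie x z + lie y z;
  lie_linearr : forall (a : F) (x y z : g),
    lie z (a *: x + y) = a *: lie z x + lie z y;
  lie_alternating : forall x : g, lie x x = 0;
  lie_jacobi : forall x y z : g,
    lie x (lie y z) + lie y (lie z x) + lie z (lie x y) = 0
}.

#[short(type="lieType")]
HB.structure Definition Lie (F : fieldType) := {g of isLie F g & Vector F g}.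

Section LieAlgebra.
Variables (F : fieldType) (g : lieType F).
Implicit Types U V I b n : {vspace g}.

Definition lie_prod U V : {vspace g} :=
  <<[seq lie u v | u <- vbasis U, v <- vbasis V]>>%VS.

Definition lie_ideal b I : Prop := (I <= b)%VS /\ (lie_prod b I <= I)%VS.

Definition lower_central I (k : nat) : {vspace g} := iter k (lie_prod I) I.

Definition nilpotent_lie I : Prop := exists k, lower_central I k = 0%VS.

Definition nilradical b n : Prop :=
  [/\ lie_ideal b n, nilpotent_lie n
    & forall I, lie_ideal b I -> nilpotent_lie I -> (I <= n)%VS].

End LieAlgebra.

(* [(a1, a2, a3, a4)] is the vector a1 alpha1 + ... + a4 alpha4 of the root
   lattice; the group structure is the componentwise one. *)
Notation weight := (int * int * int * int)%type.

Definition alpha1 : weight := (1, 0, 0, 0)%Z.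
Definition alpha2 : weight := (0, 1, 0, 0)%Z.
Definition alpha3 : weight := (0, 0, 1, 0)%Z.
Definition alpha4 : weight := (0, 0, 0, 1)%Z.

Definition simple_root (i : 'I_4) : weight :=
  nth 0 [:: alpha1; alpha2; alpha3; alpha4] i.

(* Listed in increasing lexicographic order, i.e. from a to x in the letter
   notation for the positive roots. *)
Definition pos_roots : seq weight := [::
  (0, 0, 0, 1); (0, 0, 1, 0); (0, 0, 1, 1); (0, 1, 0, 0);
  (0, 1, 1, 0); (0, 1, 1, 1); (0, 1, 2, 0); (0, 1, 2, 1);
  (0, 1, 2, 2); (1, 0, 0, 0); (1, 1, 0, 0); (1, 1, 1, 0);
  (1, 1, 1, 1); (1, 1, 2, 0); (1, 1, 2, 1); (1, 1, 2, 2);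
  (1, 2, 2, 0); (1, 2, 2, 1); (1, 2, 2, 2); (1, 2, 3, 1);
  (1, 2, 3, 2); (1, 2, 4, 2); (1, 3, 4, 2); (2, 3, 4, 2)]%Z.

Definition F4_roots : seq weight := pos_roots ++ [seq - a | a <- pos_roots].

(* Twice the standard coordinates of R^4, for alpha1 = eps2 - eps3,
   alpha2 = eps3 - eps4, alpha3 = eps4,
   alpha4 = (eps1 - eps2 - eps3 - eps4) / 2. *)
Definition twice_eps (a : weight) : weight :=
  let: (a1, a2, a3, a4) := a in
  (a4, a1 *+ 2 - a4, (a2 - a1) *+ 2 - a4, (a3 - a2) *+ 2 - a4).

(* 4 (a, b) for the standard scalar product of R^4 *)
Definition scal (a b : weight) : int :=
  let: (x1, x2, x3, x4) := twice_eps a in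
  let: (y1, y2, y3, y4) := twice_eps b in
  x1 * y1 + x2 * y2 + x3 * y3 + x4 * y4.

(* The Cartan integer 2 (b, a) / (a, a); exact on roots, see cartan_int_exact. *)
Definition cartan_int (b a : weight) : int := (2 * scal b a %/ scal a a)%Z.

(* The coefficient a_i (alpha_i, alpha_i) / (a, a) of the coroot of alpha_i in
   the coroot of a; exact on roots, see coroot_coef_exact. *)
Definition coroot_coef (a : weight) (i : 'I_4) : int :=
  let: (a1, a2, a3, a4) := a in
  (nth 0 [:: a1; a2; a3; a4] i * scal (simple_root i) (simple_root i)
     %/ scal a a)%Z.

(* The largest r such that b - r a is a root (for a root b independent of the
   root a); root strings have at most four elements, so r <= 3. *)
Definition string_down (a b : weight) : nat :=
  last 0%N [seq r <- iota 0 4 | b - a *+ r \in F4_roots].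

Definition lex_lt (a b : weight) : bool :=
  let: (a1, a2, a3, a4) := a in
  let: (b1, b2, b3, b4) := b in
  [|| a1 < b1
    , (a1 == b1) && (a2 < b2)
    , [&& a1 == b1, a2 == b2 & a3 < b3]
    | [&& a1 == b1, a2 == b2, a3 == b3 & a4 < b4]].

(* The roots +-eps_i, +-eps_i +- eps_j (i < j) and
   (+-eps1 +-eps2 +-eps3 +-eps4) / 2, all multiplied by 2. *)
Definition std_F4 : seq weight :=
  let e1 : weight := (2, 0, 0, 0)%Z in let e2 : weight := (0, 2, 0, 0)%Z in
  let e3 : weight := (0, 0, 2, 0)%Z in let e4 : weight := (0, 0, 0, 2)%Z in
  let pm (a : weight) := [:: a; - a] in
  let pm2 := [seq (x, y) | x <- [:: 1; -1], y <- [:: 1; -1]]%Z in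
  flatten [seq pm a | a <- [:: e1; e2; e3; e4]]
  ++ flatten [seq [seq a + b | a <- pm p.1, b <- pm p.2]
             | p <- [:: (e1, e2); (e1, e3); (e1, e4);
                        (e2, e3); (e2, e4); (e3, e4)]]
  ++ [seq (p.1, p.2, q.1, q.2) | p <- pm2, q <- pm2].

Fact roots_std_F4 : perm_eq [seq twice_eps a | a <- F4_roots] std_F4.
Proof. by vm_compute. Qed.

Fact cartan_int_exact :
  all (fun a => all (fun b => scal a a %| 2 * scal b a)%Z F4_roots) F4_roots.
Proof. by vm_compute. Qed.

Fact coroot_coef_exact :
  all (fun a => let: (a1, a2, a3, a4) := a in
    all (fun p => scal a a %| p.1 * scal p.2 p.2)%Z
      [:: (a1, alpha1); (a2, alpha2); (a3, alpha3); (a4, alpha4)]) F4_roots.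
Proof. by vm_compute. Qed.

Fact pos_roots_increasing : sorted lex_lt pos_roots.
Proof. by vm_compute. Qed.

Section TypeF4.
Variables (F : fieldType) (g : lieType F).
Implicit Types (h : 'I_4 -> g) (x : weight -> g).

(* A Lie algebra over F is the (split) Lie algebra of type F4 when it has a
   Chevalley basis, made of simple coroots h and of root vectors x. The values
   of x outside of the 48 roots are irrelevant. *)
Definition chevalley_basis h x : Prop :=
  basis_of fullv ([seq h i | i : 'I_4] ++ [seq x a | a <- F4_roots])
  /\ exists N : weight -> weight -> int,
  [/\ forall i j, lie (h i) (h j) = 0,
      forall i a, a \in F4_roots ->
        lie (h i) (x a) = (cartan_int a (simple_root i))%:~R *: x a,
      forall a, a \in F4_roots ->
        lie (x a) (x (- a)) = \sum_i (coroot_coef a i)%:~R *: h i,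
      forall a b, a \in F4_roots -> b \in F4_roots ->
        a + b \notin F4_roots -> a + b != 0 -> lie (x a) (x b) = 0
    & forall a b, a \in F4_roots -> b \in F4_roots -> a + b \in F4_roots ->
        [/\ lie (x a) (x b) = (N a b)%:~R *: x (a + b),
            `|N a b|%N = (string_down a b).+1
          & N (- a) (- b) = - N a b]].

Definition borel h x : {vspace g} :=
  <<[seq h i | i : 'I_4] ++ [seq x a | a <- pos_roots]>>%VS.

Definition root_vector h (a : weight) (v : g) : Prop :=
  v != 0 /\
  forall i, lie (h i) v = (cartan_int a (simple_root i))%:~R *: v.

Definition normalized (e : weight -> g) : Prop :=
  [/\ lie (e alpha2) (e alpha1) = e (alpha1 + alpha2),
      lie (e (alpha2 + alpha3 *+ 2)) (e alpha1)
        = e (alpha1 + alpha2 + alpha3 *+ 2)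
    & [/\ lie (e alpha4) (e (alpha2 + alpha3)) = e (alpha2 + alpha3 + alpha4),
          lie (e (alpha3 + alpha4)) (e alpha2) = e (alpha2 + alpha3 + alpha4),
          lie (e alpha4) (e (alpha2 + alpha3 *+ 2))
            = e (alpha2 + alpha3 *+ 2 + alpha4)
        & lie (e (alpha3 + alpha4)) (e (alpha2 + alpha3))
            = - e (alpha2 + alpha3 *+ 2 + alpha4)]].

Variable (n : {vspace g}).
Implicit Types (e : weight -> g) (lam : 'Hom(subvs_of n, F^o)).

(* lam at an element v of n, given as an element of g *)
Definition form_at lam (v : g) : F := lam (vsproj n v).

Definition supp e lam : seq weight :=
  [seq a <- pos_roots | form_at lam (e a) != 0].

Definition bracket_matrix e lam (rows : seq weight) :
    'M[F]_(size rows, size pos_roots) :=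
  \matrix_(i < size rows, j < size pos_roots)
     form_at lam (lie (e (nth 0 rows i)) (e (nth 0 pos_roots j))).

Definition rows_ge (c : weight) : seq weight :=
  [seq a <- pos_roots | (a == c) || lex_lt c a].

Definition rows_gt (c : weight) : seq weight :=
  [seq a <- pos_roots | lex_lt c a].

Definition A_mx e lam (c : weight) := bracket_matrix e lam (rows_ge c).

Definition B_mx e lam (c : weight) := bracket_matrix e lam (rows_gt c).

Definition in_S e lam : Prop :=
  forall c, c \in supp e lam -> \rank (A_mx e lam c) = \rank (B_mx e lam c).

End TypeF4.

(* The letter a is the first positive root, ..., x the last one. Any other
   character, such as the 0 denoting the empty word, stands for no root. *)
Definition letter (c : ascii) : seq weight :=
  let k := nat_of_ascii c in
  if (nat_of_ascii "a" <= k)%N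
  then take 1 (drop (k - nat_of_ascii "a") pos_roots) else [::].

Fixpoint word (s : string) : seq weight :=
  if s is String c s' then letter c ++ word s' else [::].

Fixpoint comma_words (s : string) : seq (seq weight) :=
  if s is String c s' then
    let ws := comma_words s' in
    if Ascii.eqb c ","%char then [::] :: ws
    else (letter c ++ head [::] ws) :: behead ws
  else [:: [::]].

Fixpoint subwords (w : seq weight) : seq (seq weight) :=
  if w is z :: w' then
    let ws := subwords w' in ws ++ [seq z :: u | u <- ws]
  else [:: [::]].

(* P[w1,w2,...] *)
Definition ext (P ws : string) : seq (seq weight) :=
  [seq word P ++ w | w <- comma_words ws].

(* P<z1,...,zr>, with zs the word z1...zr *)
Definition ext_sub (P zs : string) : seq (seq weight) :=
  [seq word P ++ w | w <- subwords (word zs)].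

Definition coll_E : string :=
  "0,a,b,ba,c,d,dc,db,dba,da,e,ec,eca,ea,f,fb,g,gf,gfa,gd,gdc,gdca,gda,gc,gca,ga,h,hd,i,ig,igd,ie,id,idb,ib".

Definition coll_F : string :=
  "0,h,hg,hge,hged,hgd,he,hed,hd,g,gf,gfd,gd,f,fe,fd,fdb,fb,e,d,db,b".

Definition list_L_parts : seq (seq (seq weight)) := [::
  ext "0" coll_E ++ ext "j" coll_E ++ ext "x" coll_E;
  ext "k" "0,i,ig,ie,ieb,ib,h,g,gf,gfc,gfca,gfa,gc,gca,ga,f,fc,fcb,fb,e,ec,eb,eba,ea,c,b,ba,a";
  ext "l" "0,i,ig,igd,id,h,hf,hd,hdc,hc,g,gf,gfa,gd,gdc,gdca,gda,gc,gca,ga,f,fa,d,dc,dca,da,c,ca,a";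
  ext "m" "0,i,ih,ihg,ihgd,ihe,ihd,ihdb,ihb,ig,igd,ie,id,idb,ib,h,hg,hgd,he,hd,hdb,hb,g,gd,e,d,db,b";
  ext "nm" "0,i,if,ife,ifed,ifd,ie,ied,id,h,he,hed,hd,f,fd,e,d,da,a"
    ++ ext_sub "nk" "edca" ++ ext_sub "nki" "ed" ++ ext "nk" "h,hf,f"
    ++ ext_sub "n" "edca" ++ ext_sub "ni" "ed" ++ ext "n" "h,hf,hd,hda,ha,f";
  ext_sub "o" "kigfed";
  ext_sub "pnk" "hgfed" ++ ext_sub "pn" "hgfed" ++ ext_sub "pl" "hgfed"
    ++ ext "pk" coll_F ++ ext "p" coll_F;
  ext "q" "0,p,ph,pf,pfb,pb" ++ ext "qo" "0,i,ia,f,c,ca,a"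
    ++ ext "qm" "0,i,ic,icb,ib,h,hb,c,b,ba,a"
    ++ ext "qj" "0,i,ib,h,hc,hca,ha,f,fc,fb,fba,fa,c,b,ba,a"
    ++ ext "q" "i,ib,h,hc,hca,ha,f,fc,fb,fba,fa,c,b,ba,a";
  ext "rp" "0,n,ng,nc,ncb,nb,g,c,cb,b" ++ ext "rn" "0,i,c,cb,b"
    ++ ext_sub "r" "jigcb";
  ext "sqo" "0,n,ng,nc,ncb,nb,g,c,cb,b" ++ ext "sqn" "0,h,c,cb,b"
    ++ ext_sub "sq" "jhgcb" ++ ext "so" "0,n,ng,ne,neb,nb,g,e,eb,b"
    ++ ext "sn" "0,h,e,ec,c" ++ ext_sub "sl" "hgcb"
    ++ ext "sj" "0,h,hg,hgb,hb,g,gc,e,ec,ecb,eb,c,cb,b"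
    ++ ext "s" "0,h,hg,hgb,hb,g,gc,e,ec,ecb,eb,c,cb,b";
  ext_sub "ts" "ja" ++ ext_sub "tp" "kda" ++ ext_sub "tk" "ia" ++ ext_sub "t" "jida";
  ext "u" "0,q,qj,n,nk,nkd,nd,k,kg,j,jg,jgd,jd,g,gd,d";
  ext "v" "0" ++ ext_sub "vsq" "j" ++ ext_sub "vsl" "kd" ++ ext_sub "vsk" "e"
    ++ ext_sub "vs" "jed" ++ ext_sub "vr" "j" ++ ext_sub "vqm" "kda" ++ ext_sub "vqk" "fa"
    ++ ext_sub "vq" "jfda" ++ ext_sub "vm" "ked"
    ++ ext "vl" "0,k,kf,kd,kda,ka,f,fd,fda,fa,d,da,a"
    ++ ext "vk" "0,f,e,ea,a" ++ ext "vj" "0,f,fd,e,ed,eda,ea,d,da,a"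
    ++ ext "v" "f,fd,e,ed,eda,ea,d,da,a";
  ext_sub "wpn" "kj" ++ ext_sub "wpl" "j" ++ ext_sub "wp" "kjb" ++ ext_sub "wo" "kj"
    ++ ext_sub "wnm" "ja" ++ ext_sub "wnk" "jca" ++ ext_sub "wn" "jca" ++ ext_sub "wm" "jb"
    ++ ext_sub "wl" "jca" ++ ext "wkj" "0,c,b,ba,a" ++ ext "wk" "0,c,b,ba,a"
    ++ ext "wj" "0,c,b,ba,a" ++ ext "w" "0,c,b,ba,a"].

Definition list_L : seq (seq weight) := flatten list_L_parts.

Fact shape_list_L :
  shape list_L_parts
  = [:: 105; 28; 29; 28; 68; 64; 140; 55; 47; 106; 32; 16; 92; 70]%N.
Proof. by vm_compute. Qed.

Fact size_list_L : size list_L = 880%N.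
Proof. by vm_compute. Qed.

(* The 880 words denote distinct sets of roots. *)
Fact uniq_list_L : uniq [seq [seq a <- pos_roots | a \in w] | w <- list_L].
Proof. by vm_compute. Qed.

Definition exceptional_supports : seq (seq weight) := [::
  [:: alpha1 + alpha2 + alpha3 *+ 2; alpha1 + alpha2;
      alpha2 + alpha3 *+ 2 + alpha4; alpha2 + alpha3 + alpha4; alpha2];
  [:: alpha1 + alpha2 + alpha3 *+ 2; alpha1 + alpha2;
      alpha2 + alpha3 *+ 2 + alpha4; alpha2 + alpha3 + alpha4; alpha2; alpha4];
  [:: alpha1 + alpha2 + alpha3 *+ 2; alpha1 + alpha2;
      alpha2 + alpha3 *+ 2 + alpha4; alpha2 + alpha3 + alpha4; alpha4]].

(* Main.v *)
From Stdlib Require Import Ascii String.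
From HB Require Import structures.
Require Import Defs.
From mathcomp Require Import all_boot all_order all_algebra.
Set Implicit Arguments.
Unset Strict Implicit.
Unset Printing Implicit Defensive.
Import Order.TTheory GRing.Theory Num.Theory.
Local Open Scope ring_scope.

(** The bound on the characteristic can be taken to be 5: then the integers
    of absolute value 1 to 4, the only ones by which the proof divides, are
    units of F.

    Reduction to one table of structure constants. A joint eigenvector of the
    Cartan subalgebra for a positive root a is a multiple of the Chevalley
    vector x a, so that [e_a, e_b] is a nonzero multiple of e_(a + b) when
    a + b is a root, and 0 otherwise. Rescaling the vectors e_a keeps the
    supports and multiplies the rows and the columns of the bracket matrices
    by units, hence keeps the ranks. Fourteen rescalings, which do not touch
    the vectors that occur in the normalization, give prescribed values to as
    many structure constants; together with the six normalized ones, they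
    determine the other 48 by Jacobi identities (normal_form). As the vectors
    of the roots f, h, k, n keep their scale, the exceptional equation on lam
    has the same form in the new basis.

    Reduction to linear algebra. The row of a root leaves the rank unchanged
    exactly when it vanishes on the common kernel of the rows of the larger
    roots (rank_bracket_matrix). The row of the root of index i only contains
    coordinates of lam at roots of index larger than i, and the condition on
    it matters only if the coordinate of lam at i is nonzero. Hence S is
    described by a tree: going down from the highest root, one keeps a
    spanning family of the common kernel, whose vectors have entries that are
    polynomials in the nonzero coordinates met so far. If the next row
    vanishes on the family, the next coordinate is free and the tree branches;
    otherwise the coordinate must be 0 and one step of Gaussian elimination
    gives the next family (span_elim).

    All values of rows that serve as pivots are monomials in the nonzero
    coordinates, with a coefficient of absolute value at most 4, except for
    k h^2 - n f^2 and its opposite, where letters stand for coordinates of lam.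
    Whether this polynomial vanishes is not determined by the support of lam. So
    the tree is explored twice, once for the forms lam on which this polynomial
    vanishes and once for the others; each time the branches are compared with
    the list of supports by evaluation of a boolean function (check_tree),
    whose soundness is check_tree_sound. The first exploration finds the 880
    supports of the list and the three exceptional ones, the second one finds
    only the 880 supports. *)

(** * The positive roots by index, and the table of brackets *)

Definition pos_root (i : nat) : weight := nth 0 pos_roots i.

Definition positions (w : seq weight) : seq nat :=
  [seq index a pos_roots | a <- w].

(** Sums that are not positive roots get the index 24. *)
Definition sum_index_rows : seq (seq nat) := Eval vm_compute in
  [seq [seq index (a + b) pos_roots | b <- pos_roots] | a <- pos_roots].

Definition sum_index (i j : nat) : nat :=
  nth 24%N (nth [::] sum_index_rows i) j.

(** An entry such as (beg, -2) stands for [y_b, y_e] = -2 y_g. The constants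
    agree with the normalization on the brackets that it prescribes; the
    others are those of a Chevalley basis. *)
Definition bracket_table : seq (string * int) := [::
  ("abc", 1); ("aef", 1); ("agh", 1); ("ahi", 2); ("alm", 1); ("ano", 1);
  ("aop", 2); ("aqr", 1); ("ars", 2); ("atu", 1); ("bde", 1); ("beg", -2);
  ("bfh", -1); ("bkl", 1); ("bln", -2); ("bmo", -1); ("brt", 1); ("bsu", 1);
  ("buv", 2); ("cdf", 1); ("ceh", -1); ("cfi", -2); ("ckm", 1); ("clo", -1);
  ("cmp", -2); ("cqt", -1); ("cru", -1); ("ctv", -2); ("djk", 1); ("dnq", 1);
  ("dor", 1); ("dps", 1); ("dvw", 1); ("ejl", 1); ("elq", 2); ("emr", 1);
  ("eot", 1); ("epu", 1); ("euw", -2); ("fjm", 1); ("flr", 1); ("fms", 2);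
  ("fnt", -1); ("fou", -1); ("ftw", 2); ("gjn", 1); ("gkq", 1); ("gmt", -1);
  ("gpv", -1); ("gsw", -1); ("hjo", 1); ("hkr", 1); ("hlt", 1); ("hmu", -1);
  ("hov", 2); ("hrw", 2); ("ijp", 1); ("iks", 1); ("ilu", 1); ("inv", -1);
  ("iqw", -1); ("jwx", 1); ("kvx", -1); ("lux", 2); ("mtx", -2); ("nsx", 1);
  ("orx", -2); ("pqx", 1)]%Z%string.

Definition bracket_rows : seq (seq int) := Eval vm_compute in
  let table := [seq (positions (word t.1), t.2) | t <- bracket_table] in
  let entry i j :=
    head 0 [seq if head 24%N t.1 == i then t.2 else - t.2
           | t <- table & perm_eq t.1 [:: i; j; sum_index i j]] in
  mkseq (fun i => mkseq (entry i) 24) 24.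

Definition bracket_coef (i j : nat) : int := nth 0 (nth [::] bracket_rows i) j.

Lemma pos_root_mem i : (i < 24)%N -> pos_root i \in pos_roots.
Proof. by move=> i24; apply: mem_nth. Qed.

Lemma table_entry i j : (i < 24)%N -> (j < 24)%N ->
  [/\ (bracket_coef i j != 0) = (pos_root i + pos_root j \in pos_roots),
      bracket_coef i j != 0 ->
        [/\ pos_root (sum_index i j) = pos_root i + pos_root j,
            (i < sum_index i j)%N & (sum_index i j < 24)%N],
      bracket_coef j i = - bracket_coef i j & sum_index i j = sum_index j i].
Proof.
have /allP H : all (fun i => all (fun j =>
  [&& (bracket_coef i j != 0) == (pos_root i + pos_root j \in pos_roots),
      (bracket_coef i j != 0) ==>
        [&& pos_root (sum_index i j) == pos_root i + pos_root j,
            (i < sum_index i j)%N & (sum_index i j < 24)%N],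
      bracket_coef j i == - bracket_coef i j
    & sum_index i j == sum_index j i]) (iota 0 24)) (iota 0 24).
  by vm_compute.
move=> i24 j24; have := H i; rewrite mem_iota i24 => /(_ isT)/allP/(_ j).
rewrite mem_iota j24 => /(_ isT)/and4P[/eqP ? /implyP sP /eqP ? /eqP ?].
by split=> // /sP/and3P[/eqP].
Qed.

Lemma bracket_coef_supp i j : bracket_coef i j != 0 -> (i < 24)%N /\ (j < 24)%N.
Proof.
move=> nz; have i24 : (i < 24)%N.
  apply: contraNT nz; rewrite -leqNgt => i24.
  by rewrite /bracket_coef [nth [::] _ i]nth_default ?nth_nil.
split=> //; apply: contraNT nz; rewrite -leqNgt => j24.
have /allP/(_ _ (mem_nth [::] (i24 : i < size bracket_rows)%N))/eqP rE :
  all (fun r => size r == 24) bracket_rows by [].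
by rewrite /bracket_coef [nth 0 _ j]nth_default // rE.
Qed.

(** The roots are listed in increasing order, so that adding a positive root
    increases the index: the row of a root only involves the coordinates of
    the form at larger roots. *)
Lemma bracket_coef_gt i j : bracket_coef i j != 0 -> (i < sum_index i j < 24)%N.
Proof.
move=> nz; have [i24 j24] := bracket_coef_supp nz.
by have [_ /(_ nz)[_ -> ->]] := table_entry i24 j24.
Qed.

Lemma bracket_coef_small i j : (`|bracket_coef i j| < 5)%N.
Proof.
have /allP tabP: all (all (fun m : int => `|m| < 5)%N) bracket_rows by [].
have [i24|i24] := ltnP i (size bracket_rows); last first.
  by rewrite /bracket_coef [nth [::] _ i]nth_default ?nth_nil.
have /allP rowP := tabP _ (mem_nth [::] i24).
have [jr|jr] := ltnP j (size (nth [::] bracket_rows i)).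
  by apply: rowP; apply: mem_nth.
by rewrite /bracket_coef nth_default.
Qed.

Lemma small_int_neq0 (F : nzRingType) (p : nat) (m : int) :
  p \in [pchar F] -> (5 <= p)%N -> (0 < `|m| < 5)%N -> m%:~R != 0 :> F.
Proof.
move=> pF p5 /andP[m0 m5].
have: `|m|%N%:R != 0 :> F.
  by rewrite -(dvdn_pcharf pF) gtnNdvd // (leq_trans m5).
by case: m {m0 m5} => k; rewrite ?NegzE ?abszN /= ?mulrNz ?oppr_eq0 // -pmulrn.
Qed.

(** * Root vectors *)

Lemma pos_root_F4 a : a \in pos_roots -> a \in F4_roots.
Proof. by rewrite mem_cat => ->. Qed.

Lemma pos_sum a b : a \in pos_roots -> b \in pos_roots ->
  (a + b != 0) && ((a + b \in F4_roots) == (a + b \in pos_roots)).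
Proof.
have /allP H : all (fun a => all (fun b => (a + b != 0) &&
  ((a + b \in F4_roots) == (a + b \in pos_roots))) pos_roots) pos_roots.
  by vm_compute.
by move=> /H/allP; apply.
Qed.

(** Comparing coordinates in D i v = wt i k0 *: v kills every coordinate of v
    at a basis vector whose weight differs from that of the k0-th one. *)
Lemma joint_eigenvector (F : fieldType) (V : vectType F) (I : Type)
    (D : I -> {linear V -> V}) (wt : I -> nat -> F) (X : seq V) :
    basis_of fullv X ->
    (forall i k, (k < size X)%N -> D i X`_k = wt i k *: X`_k) ->
  forall k0, (k0 < size X)%N ->
    (forall k, (k < size X)%N -> k != k0 -> exists i, wt i k != wt i k0) ->
  forall v, (forall i, D i v = wt i k0 *: v) -> exists s, v = s *: X`_k0.
Proof.
move=> bas DX k0 k0X sep v Dv.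
have freeX : free (in_tuple X) := basis_free bas.
pose c k := coord (in_tuple X) k v.
have vX : v = \sum_k c k *: X`_k.
  by rewrite -(coord_basis (X := in_tuple X) bas) // memvf.
exists (c (Ordinal k0X)); rewrite {1}vX (bigD1 (Ordinal k0X)) //=.
rewrite big1 ?addr0 // => k kNk0; have [i wtk] := sep _ (ltn_ord k) kNk0.
have /eqP : c k * (wt i k - wt i k0) = 0.
  apply: (freeP freeX (fun k => c k * (wt i k - wt i k0))).
  transitivity (D i v - wt i k0 *: v); last by rewrite Dv subrr.
  rewrite vX linear_sum scaler_sumr -sumrB; apply: eq_bigr => l _.
  by rewrite linearZ /= DX // mulrBr scalerBl !scalerA [c l * wt i k0]mulrC.
by rewrite mulf_eq0 subr_eq0 (negbTE wtk) orbF => /eqP->; rewrite scale0r.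
Qed.

Section LieBracket.
Variables (F : fieldType) (g : lieType F).

HB.instance Definition _ (u : g) := GRing.isLinear.Build F g g _ (lie u)
  (fun a v w => lie_linearr a v w u).

Lemma lieC (u v : g) : lie u v = - lie v u.
Proof.
have lieDl (a b c : g) : lie (a + b) c = lie a c + lie b c.
  by have := lie_linearl 1 a b c; rewrite !scale1r.
have := lie_alternating (u + v).
rewrite lieDl !linearD /= !lie_alternating add0r addr0 => /eqP.
by rewrite addr_eq0 => /eqP.
Qed.

Lemma lieZl (a : F) (u v : g) : lie (a *: u) v = a *: lie u v.
Proof. by rewrite lieC linearZ /= -scalerN -lieC. Qed.

End LieBracket.

Section RootVectors.
Variables (F : fieldType) (p : nat).
Hypotheses (pF : p \in [pchar F]) (p5 : (5 <= p)%N).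
Variables (g : lieType F) (h : 'I_4 -> g) (x : weight -> g).
Hypothesis hx : chevalley_basis h x.

(** The weights of the Chevalley basis: its first four vectors lie in the
    Cartan subalgebra. *)
Definition basis_weights : seq weight := nseq 4 0 ++ F4_roots.

Definition basis_weight (k : nat) : weight := nth 0 basis_weights k.

(** The differences of Cartan integers are bounded by 4, so that a weight that
    differs from a positive root still differs from it modulo p. *)
Lemma basis_weights_separated :
  all (fun a => let k0 := index a basis_weights in
    [&& (k0 < size basis_weights)%N, (4 <= k0)%N,
        basis_weight k0 == a
      & all (fun k => (k != k0) ==> has (fun s =>
         0 < `|cartan_int (basis_weight k) s - cartan_int a s| < 5)%N
         [:: alpha1; alpha2; alpha3; alpha4]) (iota 0 (size basis_weights))])
    pos_roots.
Proof. by vm_compute. Qed.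

Lemma root_vectorE a v : a \in pos_roots -> root_vector h a v ->
  exists2 s, s != 0 & v = s *: x a.
Proof.
move=> aP [nz_v vE]; have [bas [N [hh ha _ _ _]]] := hx.
have /allP/(_ a aP)/and4P[k0w k04 /eqP k0a /allP sep] := basis_weights_separated.
move: bas; set H := [seq h i | i : 'I_4]; set X := map x F4_roots => bas.
have s4 : size H = 4%N by rewrite size_image card_ord.
have sX : size (H ++ X) = size basis_weights.
  by rewrite /basis_weights !size_cat s4 size_nseq size_map.
have X_h k : (k < 4)%N -> exists j, (H ++ X)`_k = h j.
  move=> k4; have /imageP[j _ jE] : H`_k \in H by rewrite mem_nth ?s4.
  by exists j; rewrite nth_cat s4 k4.
have X_x k : (k < size (H ++ X))%N -> (4 <= k)%N ->
    (H ++ X)`_k = x (basis_weight k) /\ basis_weight k \in F4_roots.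
  rewrite size_cat s4 size_map => kX k4.
  have k48 : (k - 4 < size F4_roots)%N by rewrite ltn_subLR.
  have -> : basis_weight k = nth 0 F4_roots (k - 4).
    rewrite /basis_weight /basis_weights (nth_cat 0 (nseq 4 0)) size_nseq.
    by rewrite (leq_gtF k4).
  rewrite nth_cat s4 (leq_gtF k4); split; last exact: mem_nth.
  exact: (nth_map (0 : weight) 0 x k48).
pose wt (i : 'I_4) k : F :=
  (cartan_int (basis_weight k) (simple_root i))%:~R.
have [||||s vs] := joint_eigenvector (D := fun i => lie (h i)) (wt := wt) bas
    _ (k0 := index a basis_weights) _ _ (v := v).
- move=> i k kX; have [k4|k4] := ltnP k 4.
    have [j ->] := X_h k k4; rewrite [LHS]hh.
    rewrite /wt /basis_weight nth_cat size_nseq k4 nth_nseq k4.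
    have ->: cartan_int 0 (simple_root i) = 0.
      by case: i => [[|[|[|[|]]]]].
    by rewrite scale0r.
  by have [-> kF] := X_x _ kX k4; apply: ha.
- by rewrite sX.
- move=> k; rewrite sX => kw kk0.
  have := sep k; rewrite mem_iota kw kk0 => /(_ isT)/hasP[s sS sab].
  have i4 : (index s [:: alpha1; alpha2; alpha3; alpha4] < 4)%N.
    by rewrite index_mem.
  exists (Ordinal i4); rewrite /wt k0a /simple_root nth_index //.
  by rewrite -subr_eq0 -intrB (small_int_neq0 pF p5).
- by move=> i; rewrite /wt k0a; apply: vE.
have [xE _] := X_x _ (etrans (congr1 _ sX) k0w) k04.
move: vs; rewrite xE k0a => vs.
by exists s => //; apply: contraNneq nz_v => s0; rewrite vs s0 scale0r.
Qed.

Lemma lie_root_vectors (e : weight -> g) :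
    (forall a, a \in pos_roots -> root_vector h a (e a)) ->
  forall a b, a \in pos_roots -> b \in pos_roots ->
  if a + b \in pos_roots then
    exists2 c, c != 0 & lie (e a) (e b) = c *: e (a + b)
  else lie (e a) (e b) = 0.
Proof.
move=> eP a b aP bP; have [_ [N [_ _ _ N0 NP]]] := hx.
have [sa sa0 aE] := root_vectorE aP (eP a aP).
have [sb sb0 bE] := root_vectorE bP (eP b bP).
have /andP[ab0 /eqP abF] := pos_sum aP bP.
rewrite aE bE lieZl linearZ /= -abF; case: ifPn => abR; last first.
  (* The sum of two positive roots is never 0, nor a negative root. *)
  by rewrite (N0 a b (pos_root_F4 aP) (pos_root_F4 bP) abR ab0) !scaler0.
have abP : a + b \in pos_roots by rewrite -abF.
have [sc sc0 cE] := root_vectorE abP (eP _ abP).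
have [-> Nab _] := NP a b (pos_root_F4 aP) (pos_root_F4 bP) abR.
exists (sa * sb * (N a b)%:~R / sc); last first.
  by rewrite cE !scalerA mulfVK.
rewrite !mulf_neq0 ?invr_neq0 //; apply: small_int_neq0 pF p5 _.
(* Root strings have at most four elements, hence |N a b| <= 4. *)
rewrite Nab ltnS /= /string_down ltnS -ltnS.
have: all (fun r => (r < 4)%N) [seq r <- iota 0 4 | b - a *+ r \in F4_roots].
  by apply/allP => r; rewrite mem_filter mem_iota => /andP[].
by case/lastP: [seq _ <- _ | _] => // s r; rewrite all_rcons last_rcons => /andP[].
Qed.

End RootVectors.

(** * Rescaling to the table of brackets *)

(** K lists pairs of roots whose bracket is known to be the one of the table;
    for pairs whose sum is not a root there is nothing to know. *)
Definition pair_ok (K : seq (nat * nat)) (i j : nat) : bool :=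
  [|| bracket_coef i j == 0, (i, j) \in K | (j, i) \in K].

Definition letter_pairs (ws : seq string) : seq (nat * nat) :=
  [seq (nth 24%N (positions (word w)) 0, nth 24%N (positions (word w)) 1)
  | w <- ws].

Definition normalized_pairs := letter_pairs
  [:: "dj"; "gj"; "ae"; "cd"; "ag"; "ce"]%string.

(** In this order each of these brackets involves exactly one root that occurs
    neither in the earlier ones nor in the normalization: the root b for the
    pair ab, and the sum of the two roots for the other pairs. *)
Definition scaling_pairs := letter_pairs
  [:: "ab"; "ah"; "bk"; "al"; "an"; "ao"; "dn"; "aq"; "ar"; "br"; "at"; "bu";
      "dv"; "jw"]%string.

Definition pair_roots (ij : nat * nat) : seq nat :=
  [:: ij.1; ij.2; sum_index ij.1 ij.2].

Definition fresh_root (K : seq (nat * nat)) (ij : nat * nat) : nat :=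
  if sum_index ij.1 ij.2 \in flatten (map pair_roots K) then ij.2
  else sum_index ij.1 ij.2.

Fixpoint scalable (K ps : seq (nat * nat)) : bool :=
  if ps is ij :: ps' then
    [&& bracket_coef ij.1 ij.2 != 0, uniq (pair_roots ij),
        fresh_root K ij \notin flatten (map pair_roots K)
      & scalable (ij :: K) ps']
  else true.

Lemma scaling_pairs_ok : scalable normalized_pairs scaling_pairs.
Proof. by []. Qed.

(** In this order each Jacobi identity contains exactly one unknown structure
    constant. For the triple ijk it is a factor of the term [i, [j, k]]: the
    bracket of j and k, or that of i with their sum. *)
Definition jacobi_triples : seq (seq nat) := [seq positions (word w) | w <-
  [:: "abd"; "bcd"; "cae"; "dan"; "dao"; "gdj"; "jag"; "jah"; "jbd"; "jea";
      "kab"; "kag"; "kah"; "obd"; "qab"; "tab"; "tcd"; "tfj"; "ubd"; "uej";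
      "vdj"; "abe"; "bcr"; "bej"; "bfj"; "bra"; "cbk"; "cfj"; "ebk"; "eck";
      "efo"; "eoa"; "fbk"; "fck"; "gck"; "gcm"; "gdp"; "hbk"; "hck"; "hcl";
      "hdo"; "ibk"; "ibl"; "idn"; "nae"; "nfm"; "oem"; "pdn"]%string].

Definition jacobi_coef (i j k : nat) : int :=
  bracket_coef j k * bracket_coef i (sum_index j k).

Definition term_ok (K : seq (nat * nat)) (s i j k : nat) : bool :=
  (bracket_coef j k == 0)
  || [&& pair_ok K j k, pair_ok K i (sum_index j k)
       & (bracket_coef i (sum_index j k) != 0) ==>
           (sum_index i (sum_index j k) == s)].

Definition jacobi_step (K : seq (nat * nat)) (t : seq nat) : seq (nat * nat) :=
  if t is [:: i; j; k] then
    let s := sum_index i (sum_index j k) in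
    if [&& [&& (i < 24)%N, (j < 24)%N & (k < 24)%N],
           (bracket_coef j k != 0) && (bracket_coef i (sum_index j k) != 0),
           pair_ok K j k || pair_ok K i (sum_index j k),
           term_ok K s j k i, term_ok K s k i j
         & jacobi_coef i j k + jacobi_coef j k i + jacobi_coef k i j == 0] then
      if pair_ok K j k then (i, sum_index j k) :: K else (j, k) :: K
    else K
  else K.

Definition all_pairs_known : bool :=
  let K := foldl jacobi_step (rev scaling_pairs ++ normalized_pairs)
             jacobi_triples in
  all (fun i => all (pair_ok K i) (iota 0 24)) (iota 0 24).

Section Normalization.
Variables (F : fieldType) (p : nat).
Hypotheses (pF : p \in [pchar F]) (p5 : (5 <= p)%N).
Variables (g : lieType F) (e : weight -> g).
Hypothesis e_neq0 : forall a, a \in pos_roots -> e a != 0.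
Hypothesis e_lie : forall a b, a \in pos_roots -> b \in pos_roots ->
  if a + b \in pos_roots then
    exists2 c, c != 0 & lie (e a) (e b) = c *: e (a + b)
  else lie (e a) (e b) = 0.

Definition rescaled (t : nat -> F) (i : nat) : g := t i *: e (pos_root i).

Definition bracket_holds (t : nat -> F) (ij : nat * nat) : Prop :=
  lie (rescaled t ij.1) (rescaled t ij.2)
  = (bracket_coef ij.1 ij.2)%:~R *: rescaled t (sum_index ij.1 ij.2).

Lemma bracket_coef_unit i j :
  bracket_coef i j != 0 -> (bracket_coef i j)%:~R != 0 :> F.
Proof.
by move=> nz; rewrite (small_int_neq0 pF p5) // absz_gt0 nz bracket_coef_small.
Qed.

Lemma lie_rescaled t i j : (forall k, t k != 0) -> (i < 24)%N -> (j < 24)%N ->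
  if bracket_coef i j != 0 then
    exists2 c, c != 0
             & lie (rescaled t i) (rescaled t j) = c *: rescaled t (sum_index i j)
  else lie (rescaled t i) (rescaled t j) = 0.
Proof.
move=> t0 i24 j24; have [ncE sumE' _ _] := table_entry i24 j24.
have := e_lie (pos_root_mem i24) (pos_root_mem j24); rewrite -ncE.
rewrite /rescaled lieZl linearZ /=; case: ifP => [/sumE'[-> _ _] [c c0 ->]|_ ->].
  exists (t i * t j * c / t (sum_index i j)); first by rewrite !mulf_neq0 ?invr_neq0.
  by rewrite !scalerA mulfVK.
by rewrite !scaler0.
Qed.

Lemma pair_okP t K i j : (forall k, t k != 0) -> (i < 24)%N -> (j < 24)%N ->
    (forall ij, ij \in K -> bracket_holds t ij) ->
  pair_ok K i j -> bracket_holds t (i, j).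
Proof.
move=> t0 i24 j24 KP /or3P[/eqP nc0|/KP//|/KP].
  have := lie_rescaled t0 i24 j24.
  by rewrite /bracket_holds /= nc0 eqxx scale0r.
have [_ _ ncE sumE'] := table_entry i24 j24.
rewrite /bracket_holds /= => ji.
by rewrite lieC ji ncE -sumE' mulrNz scaleNr opprK.
Qed.

(** Scaling the vector of a root that occurs in no bracket of K keeps these
    brackets, and can be used to adjust a new bracket in which it occurs. *)
Lemma scaling_step t K ij : (forall k, t k != 0) ->
    (forall ij, ij \in K -> bracket_holds t ij) ->
    bracket_coef ij.1 ij.2 != 0 -> uniq (pair_roots ij) ->
    fresh_root K ij \notin flatten (map pair_roots K) ->
  exists t', [/\ forall k, t' k != 0,
    forall ij', ij' \in ij :: K -> bracket_holds t' ij'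
    & forall k, k \in flatten (map pair_roots K) -> t' k = t k].
Proof.
move=> t0 KP nz; case: ij nz => i j /= nz.
have [i24 j24] := bracket_coef_supp nz.
have := lie_rescaled t0 i24 j24; rewrite nz => -[c c0 lieE].
rewrite !inE !negb_or => /and3P[/andP[ij i_s] js _].
set r := fresh_root K _ => rK.
pose f := if r == j then (bracket_coef i j)%:~R / c
          else c / (bracket_coef i j)%:~R.
have f0 : f != 0.
  by rewrite /f; case: ifP; rewrite mulf_neq0 ?invr_neq0 ?bracket_coef_unit.
pose t' k := if k == r then f * t k else t k.
have t'K k : k \in flatten (map pair_roots K) -> t' k = t k.
  by rewrite /t'; case: eqP => // ->; rewrite (negbTE rK).
exists t'; split=> // [k|ij'].
  by rewrite /t'; case: ifP; rewrite ?mulf_neq0.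
rewrite inE => /predU1P[->|ij'K]; last first.
  have := KP _ ij'K; rewrite /bracket_holds /rescaled !t'K //;
  by apply/flattenP; exists (pair_roots ij'); rewrite ?map_f ?inE ?eqxx ?orbT.
rewrite /bracket_holds /=.
have rE : r = j \/ r = sum_index i j.
  by rewrite /r /fresh_root; case: ifP; [left|right].
have tE k : rescaled t' k = if k == r then f *: rescaled t k else rescaled t k.
  by rewrite /rescaled /t'; case: ifP; rewrite ?scalerA.
rewrite !tE; case: rE => rE; rewrite rE /f rE eqxx.
  rewrite (negbTE ij) [sum_index i j == j]eq_sym (negbTE js) linearZ /= lieE.
  rewrite scalerA.
  by rewrite mulfVK.
rewrite (negbTE i_s) (negbTE js) [sum_index i j == j]eq_sym (negbTE js) lieE.
by rewrite [RHS]scalerA mulrCA mulfV ?mulr1 ?bracket_coef_unit.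
Qed.

Lemma scaling_steps t K ps : (forall k, t k != 0) ->
    (forall ij, ij \in K -> bracket_holds t ij) -> scalable K ps ->
  exists t', [/\ forall k, t' k != 0,
    forall ij, ij \in rev ps ++ K -> bracket_holds t' ij
    & forall k, k \in flatten (map pair_roots K) -> t' k = t k].
Proof.
elim: ps t K => [|ij ps IHps] t K t0 KP /=; first by exists t.
case/and4P => nz uij rK /(IHps _ _)IH.
have [t1 [t1_0 KP1 t1E]] := scaling_step t0 KP nz uij rK.
have [t' [t'0 KP' t'E]] := IH _ t1_0 KP1.
exists t'; split=> // [ij'|k kK]; first by rewrite rev_cons cat_rcons; apply: KP'.
by rewrite t'E ?t1E //= !inE kK !orbT.
Qed.

Lemma term_okP t K s i j k : (forall k, t k != 0) ->
    (forall ij, ij \in K -> bracket_holds t ij) ->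
    (i < 24)%N -> (j < 24)%N -> (k < 24)%N -> term_ok K s i j k ->
  lie (rescaled t i) (lie (rescaled t j) (rescaled t k))
  = (jacobi_coef i j k)%:~R *: rescaled t s.
Proof.
move=> t0 KP i24 j24 k24; rewrite /jacobi_coef; case/orP => [/eqP nc0|].
  have := lie_rescaled t0 j24 k24; rewrite nc0 eqxx /= => ->.
  by rewrite linear0 mul0r scale0r.
case/and3P => /(pair_okP t0 j24 k24 KP) -> ok2 /implyP sE.
have [nc0|nz] := eqVneq (bracket_coef j k) 0.
  by rewrite nc0 mul0r !scale0r linear0.
have /andP[_ s24] := bracket_coef_gt nz.
rewrite linearZ /= (pair_okP t0 i24 s24 KP ok2) intrM scalerA /=.
have [nc0|nz'] := eqVneq (bracket_coef i (sum_index j k)) 0.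
  by rewrite nc0 mulr0 !scale0r.
by rewrite (eqP (sE nz')).
Qed.

(** The two other terms of the Jacobi identity are those of the table, and so
    is one factor of the first term, which is a unit: the identity determines
    the remaining factor, and the table satisfies the same identity. *)
Lemma jacobi_stepP t K w : (forall k, t k != 0) ->
    (forall ij, ij \in K -> bracket_holds t ij) ->
  forall ij, ij \in jacobi_step K w -> bracket_holds t ij.
Proof.
move=> t0 KP; case: w => [|i [|j [|k [|]]]] //=.
case: ifP => // /and5P[/and3P[i24 j24 k24] /andP[nz1 nz2] ok1 okj].
case/andP => okk /eqP sum0.
have /andP[_ jk24] := bracket_coef_gt nz1.
have /andP[_ s24] := bracket_coef_gt nz2.
have first : lie (rescaled t i) (lie (rescaled t j) (rescaled t k))
    = (jacobi_coef i j k)%:~R *: rescaled t (sum_index i (sum_index j k)).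
  have /eqP := lie_jacobi (rescaled t i) (rescaled t j) (rescaled t k).
  rewrite (term_okP t0 KP j24 k24 i24 okj) (term_okP t0 KP k24 i24 j24 okk).
  rewrite -addrA -scalerDl -intrD addr_eq0 => /eqP->.
  rewrite -scaleNr -intrN; congr (_%:~R *: _).
  by apply/eqP; rewrite eq_sym -addr_eq0 addrA sum0.
have nzs : rescaled t (sum_index i (sum_index j k)) != 0.
  by rewrite scaler_eq0 (negbTE (t0 _)) (negbTE (e_neq0 (pos_root_mem s24))).
move: first; case: ifP ok1 => [ok _|_ /= ok] first ij.
  rewrite inE => /predU1P[->|/KP//].
  move: first; rewrite (pair_okP t0 j24 k24 KP ok) linearZ /=.
  by rewrite /jacobi_coef intrM -scalerA => /(scalerI (bracket_coef_unit nz1)).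
rewrite inE => /predU1P[->|/KP//].
have := lie_rescaled t0 j24 k24; rewrite nz1 => -[c _ jkE].
move: first; rewrite /bracket_holds /= jkE linearZ /=.
rewrite (pair_okP t0 i24 jk24 KP ok) /=.
move: (rescaled t (sum_index i _)) nzs => R nzR.
rewrite /jacobi_coef intrM scalerA => /eqP.
rewrite -subr_eq0 -scalerBl scaler_eq0 (negbTE nzR) orbF -mulrBl mulf_eq0.
by rewrite (negbTE (bracket_coef_unit nz2)) orbF subr_eq0 => /eqP->.
Qed.

(** The vectors of the roots f, h, k, n are not rescaled because these roots
    occur in the normalization; this keeps the exceptional equation. *)
Lemma normal_form : normalized e -> exists t : nat -> F,
  [/\ forall k, t k != 0,
      forall i j, (i < 24)%N -> (j < 24)%N -> bracket_holds t (i, j)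
    & forall k, k \in positions (word "fhkn") -> t k = 1].
Proof.
move=> [n1 n2 [n3 n4 n5 n6]].
have one0 (k : nat) : 1 != 0 :> F by rewrite oner_neq0.
have K0 ij : ij \in normalized_pairs -> bracket_holds (fun=> 1) ij.
  move=> ijK; rewrite /bracket_holds /rescaled !scale1r; move: ijK.
  rewrite /normalized_pairs /letter_pairs /= !inE.
  by do ![case/predU1P => [->|]] => [|||||/eqP->];
    rewrite -?[bracket_coef _ _]/(1 : int) -?[bracket_coef _ _]/(-1 : int);
    rewrite ?scale1r ?scaleN1r.
have [t [t0 tP tE]] := scaling_steps one0 K0 scaling_pairs_ok.
exists t; split=> // [i j i24 j24|k kf]; last first.
  by rewrite tE //; move: kf; apply: (allP (_ : all _ _)).
have: forall ij, ij \in foldl jacobi_step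
    (rev scaling_pairs ++ normalized_pairs) jacobi_triples -> bracket_holds t ij.
  elim: jacobi_triples (rev _ ++ _) tP => //= w ws IHw K KP.
  by apply: IHw; apply: jacobi_stepP.
move/(pair_okP t0 i24 j24); apply.
have /allP : all_pairs_known by vm_compute.
move/(_ i); rewrite mem_iota i24 => /(_ isT)/allP; apply.
by rewrite mem_iota.
Qed.

End Normalization.

(** * Ranks and kernels *)

(** A row lies in the row space of B if and only if it vanishes on the kernel
    of B, which the columns of the cokernel matrix of B generate. *)
Lemma rank_col_mx (F : fieldType) (m n : nat) (r : 'rV[F]_n) (B : 'M[F]_(m, n)) :
  \rank (col_mx r B) = \rank B <-> forall u : 'cV_n, B *m u = 0 -> r *m u = 0.
Proof.
rewrite -addsmxE; split=> [rkE u Bu|ker].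
  have /submxP[D ->] : (r <= B)%MS.
    rewrite (submx_trans (addsmxSl r B)) //.
    by rewrite -(geq_leqif (mxrank_leqif_sup (addsmxSr r B))) rkE.
  by rewrite -mulmxA Bu mulmx0.
suff rB : (r <= B)%MS by rewrite (addsmx_idPr rB).
rewrite submxE; apply/eqP/matrixP => i j; rewrite [RHS]mxE ord1.
have /(congr1 (fun A : 'M_1 => A 0 0)) : r *m col j (cokermx B) = 0.
  by apply: ker; rewrite colE mulmxA mulmx_coker mul0mx.
by rewrite colE mulmxA -colE !mxE.
Qed.

Lemma rows_above i : (i < 24)%N ->
  rows_ge (pos_root i) = pos_root i :: rows_gt (pos_root i)
  /\ rows_gt (pos_root i) = drop i.+1 pos_roots.
Proof.
have /allP H : all (fun i =>
  (rows_ge (pos_root i) == pos_root i :: rows_gt (pos_root i))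
  && (rows_gt (pos_root i) == drop i.+1 pos_roots)) (iota 0 24) by vm_compute.
by move=> i24; have := H i; rewrite mem_iota i24 => /(_ isT)/andP[/eqP ? /eqP].
Qed.

Section RankConditions.
Variables (F : fieldType) (g : lieType F) (n : {vspace g}).
Variables (e : weight -> g) (lam : 'Hom(subvs_of n, F^o)).

Lemma rank_bracket_matrix i : (i < 24)%N ->
  \rank (A_mx e lam (pos_root i)) = \rank (B_mx e lam (pos_root i)) <->
  forall u : 'cV[F]_24,
    (forall j, (i < j < 24)%N ->
       \sum_(k < 24) form_at lam (lie (e (pos_root j)) (e (pos_root k)))
         * u k 0 = 0) ->
  \sum_(k < 24) form_at lam (lie (e (pos_root i)) (e (pos_root k))) * u k 0 = 0.
Proof.
move=> i24; have [geE gtE] := rows_above i24.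
rewrite /A_mx /B_mx geE; move: (rows_gt (pos_root i)) gtE => R gtE {geE}.
have sR : size R = (24 - i.+1)%N by rewrite gtE size_drop.
have nthR k : nth 0 R k = pos_root (i.+1 + k) by rewrite gtE nth_drop.
pose r : 'rV[F]_24 := \row_k form_at lam (lie (e (pos_root i)) (e (pos_root k))).
have ->: bracket_matrix e lam (pos_root i :: R)
       = col_mx r (bracket_matrix e lam R).
  apply/matrixP => j k; rewrite !mxE; case: splitP => j' jE; rewrite !mxE jE //.
  by rewrite ord1.
apply: iff_trans (rank_col_mx _ _) _; split=> ker u uP.
  have /(congr1 (fun A : 'M_1 => A 0 0)) : r *m u = 0.
    apply: ker; apply/matrixP => j l; rewrite [RHS]mxE ord1 mxE.
    have jlt : (i.+1 + j < 24)%N.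
      by have := ltn_ord j; rewrite [X in (_ < X)%N]sR ltn_subRL.
    rewrite -[RHS](uP (i.+1 + j)%N) ?jlt ?leq_addr //.
    by apply: eq_bigr => k _; rewrite mxE nthR.
  by rewrite !mxE => ru; rewrite -[RHS]ru; apply: eq_bigr => k _; rewrite mxE.
apply/matrixP => l l'; rewrite !ord1 [RHS]mxE mxE.
rewrite -[RHS](ker u) => [|j /andP[ij j24]].
  by apply: eq_bigr => k _; rewrite mxE.
have jlt : (j - i.+1 < size R)%N.
  by rewrite sR ltn_sub2r // (leq_ltn_trans ij j24).
have /(congr1 (fun A : 'cV_(size R) => A (Ordinal jlt) 0)) := uP.
rewrite !mxE => uPj; rewrite -[RHS]uPj.
by apply: eq_bigr => k _; rewrite mxE nthR subnKC.
Qed.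

End RankConditions.

(** * Symbolic Gaussian elimination *)

(** The term (j, (c, m)) stands for c times the product of the variables of
    index in m times the j-th vector of a family; each variable will be given
    the value of lam at the corresponding root. A list of terms stands for
    their sum. A polynomial is a list of terms with j = 0. *)
Notation term := (nat * (int * seq nat))%type.

Fixpoint add_term (t : term) (v : seq term) : seq term :=
  if v is u :: v' then
    if (u.1 == t.1) && perm_eq u.2.2 t.2.2 then
      let c := u.2.1 + t.2.1 in
      if c == 0 then v' else (u.1, (c, u.2.2)) :: v'
    else u :: add_term t v'
  else [:: t].

Definition add_comb (v w : seq term) : seq term := foldr add_term w v.

Definition opp_comb (v : seq term) : seq term :=
  [seq (t.1, (- t.2.1, t.2.2)) | t <- v].

Definition scale_comb (q v : seq term) : seq term :=
  foldr add_term [::]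
    [seq (u.1, (t.2.1 * u.2.1, t.2.2 ++ u.2.2)) | t <- q, u <- v].

Definition strip_var (sup : seq nat) (i : nat) (v : seq term) : seq term :=
  if (i \in sup) && all (fun t : term => i \in t.2.2) v
  then [seq (t.1, (t.2.1, rem i t.2.2)) | t <- v] else v.

(** Vectors of the spanning families matter only up to units, so that common
    variables with nonzero value can be cancelled. This keeps degrees low, and
    makes the exceptional polynomial appear without a monomial factor. *)
Definition strip (sup : seq nat) (v : seq term) : seq term :=
  if v is t :: _ then foldr (strip_var sup) v t.2.2 else v.

(** The value on v of the row of index i of the bracket matrix, where sup is
    the set of the indices larger than i at which lam does not vanish. *)
Definition row_value (sup : seq nat) (i : nat) (v : seq term) : seq term :=
  foldr add_term [::]
    [seq (0%N, (bracket_coef i t.1 * t.2.1, sum_index i t.1 :: t.2.2))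
    | t <- v & (bracket_coef i t.1 != 0) && (sum_index i t.1 \in sup)].

(** The exceptional polynomial k h^2 - n f^2. *)
Definition disc : seq term := Eval vm_compute in
  [:: (0%N, (1, positions (word "khh"))); (0%N, (-1, positions (word "nff")))].

Definition is_disc (q : seq term) : bool :=
  (add_comb q disc == [::]) || (add_comb q (opp_comb disc) == [::]).

(** The exceptional polynomial is assumed to vanish if b holds, and not to
    vanish otherwise. *)
Definition zero_val (b : bool) (q : seq term) : bool :=
  nilp q || b && is_disc q.

Definition unit_val (b : bool) (sup : seq nat) (q : seq term) : bool :=
  if q is [:: t] then (0 < `|t.2.1| < 5)%N && all (mem sup) t.2.2
  else ~~ b && is_disc q.

(** The coordinates of lam of index at least g have been treated: sup lists
    those that are nonzero, K represents a spanning family of the common kernel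
    of the rows of index at least g, and Ls contains the supports of the list
    that agree with sup on these indices. *)
Fixpoint check_tree (b : bool) (g : nat) (sup : seq nat) (K : seq (seq term))
    (Ls : seq (seq nat)) : bool :=
  if g is g'.+1 then
    let KV := [seq (v, row_value sup g' v) | v <- K] in
    if all (fun p => zero_val b p.2) KV then
      check_tree b g' sup K [seq w <- Ls | g' \notin w]
      && check_tree b g' (g' :: sup) K [seq w <- Ls | g' \in w]
    else if [seq p <- KV | unit_val b sup p.2] is (v, q) :: _ then
      (* The pivot v itself becomes 0 and can stay in the family. *)
      all (fun w => g' \notin w) Ls &&
      check_tree b g' sup
        [seq if zero_val b p.2 then p.1 else
           strip sup (add_comb (scale_comb q p.1)
                               (scale_comb (opp_comb p.2) v)) | p <- KV] Ls
    else false
  else ~~ nilp Ls.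

Definition unit_vec (j : nat) : seq term := [:: (j, (1, [::]))].

Definition std_basis : seq (seq term) := [seq unit_vec j | j <- iota 0 24].

Definition supports (b : bool) : seq (seq weight) :=
  if b then list_L ++ exceptional_supports else list_L.

Section Combinations.
Variables (F : fieldType) (L : nat -> F).

Definition term_coef (t : term) : F := t.2.1%:~R * \prod_(i <- t.2.2) L i.

Definition comb (V : lmodType F) (y : nat -> V) (v : seq term) : V :=
  \sum_(t <- v) term_coef t *: y t.1.

(** Values of polynomials are combinations of the constant family 1 of F^o, so
    that the lemmas on combinations apply to polynomials as well. *)
Definition poly_val (q : seq term) : F := comb (fun=> 1 : F^o) q.

Variables (V : lmodType F) (y : nat -> V).

Lemma comb_add_term t v :
  comb y (add_term t v) = term_coef t *: y t.1 + comb y v.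
Proof.
rewrite /comb; elim: v => [|u v IHv] /=; first by rewrite big_cons big_nil.
case: ifP => [/andP[/eqP eq1 eqm]|_]; last by rewrite !big_cons IHv addrCA.
have ->: term_coef t *: y t.1 + \sum_(j <- u :: v) term_coef j *: y j.1
       = ((u.2.1 + t.2.1)%:~R * \prod_(i <- u.2.2) L i) *: y u.1
         + \sum_(j <- v) term_coef j *: y j.1.
  rewrite big_cons addrA; congr (_ + _).
  by rewrite /term_coef -(perm_big _ eqm) /= eq1 -scalerDl -mulrDl -intrD addrC.
case: eqP => [->|_]; last by rewrite big_cons.
by rewrite mul0r scale0r add0r.
Qed.

Lemma comb_foldr v w : comb y (foldr add_term w v) = comb y v + comb y w.
Proof.
elim: v => [|t v IHv] /=; first by rewrite {2}/comb big_nil add0r.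
by rewrite comb_add_term IHv [in RHS]/comb big_cons addrA.
Qed.

Lemma comb_opp v : comb y (opp_comb v) = - comb y v.
Proof.
rewrite /comb /opp_comb big_map -sumrN; apply: eq_bigr => t _.
by rewrite /term_coef /= intrN mulNr scaleNr.
Qed.

Lemma comb_scale q v : comb y (scale_comb q v) = poly_val q *: comb y v.
Proof.
rewrite /scale_comb comb_foldr [X in _ + X]/comb big_nil addr0.
rewrite /poly_val /comb big_allpairs_dep /= scaler_suml; apply: eq_bigr => t _.
rewrite scaler_sumr; apply: eq_bigr => u _.
rewrite scalerA; congr (_ *: _).
by rewrite /term_coef /= big_cat intrM /= [_ *: 1]mulr1 mulrACA.
Qed.

Lemma comb_strip_var sup i v : {in sup, forall j, L j != 0} ->
  exists2 a, a != 0 & comb y v = a *: comb y (strip_var sup i v).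
Proof.
move=> supP; rewrite /strip_var.
case: ifP => [/andP[isup /allP iv]|_]; last first.
  by exists 1; rewrite ?oner_neq0 ?scale1r.
exists (L i); first exact: supP.
rewrite /comb big_map scaler_sumr !big_seq; apply: eq_bigr => t /iv it.
rewrite scalerA; congr (_ *: _).
by rewrite /term_coef /= (perm_big _ (perm_to_rem it)) big_cons mulrCA.
Qed.

Lemma comb_strip sup v : {in sup, forall j, L j != 0} ->
  exists2 a, a != 0 & comb y v = a *: comb y (strip sup v).
Proof.
move=> supP; rewrite /strip; case: v => [|t v].
  by exists 1; rewrite ?oner_neq0 ?scale1r.
move: (t :: v) => w; elim: {t v}t.2.2 => [|i m [a nz_a ->]] /=.
  by exists 1; rewrite ?oner_neq0 ?scale1r.
have [b nz_b ->] := comb_strip_var i (foldr (strip_var sup) w m) supP.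
by exists (a * b); rewrite ?mulf_neq0 ?scalerA.
Qed.

End Combinations.

(** Gaussian elimination: when f does not vanish at X v, the linear map
    u |-> u - (f u / f (X v)) X v is the projection of the span of X onto the
    kernel of f along X v, hence the images of the generators span this
    kernel. *)
Lemma span_elim (F : fieldType) (V : vectType F) (f : {linear V -> F^o})
    (T : eqType) (s : seq T) (X X' : T -> V) (v : T) :
  v \in s -> f (X v) != 0 ->
  {in s, forall w, exists2 a, a != 0 &
     X w - (f (X w) / f (X v)) *: X v = a *: X' w} ->
  forall u, u \in <<map X s>>%VS /\ f u = 0 <-> u \in <<map X' s>>%VS.
Proof.
move=> vs fv0 XX' u.
pose p (w : V) := w - (f w / f (X v) : F) *: X v.
have p_lin : linear p.
  move=> a w w'; rewrite /p linearP /= mulrDl scalerDl scalerBr scalerA.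
  by rewrite [_ *: f w]/(_ * _) mulrA opprD addrACA.
pose pM := GRing.isLinear.Build F V V _ p p_lin.
pose pL : {linear V -> V} := HB.pack p pM.
have fp w : f (p w) = 0.
  by rewrite linearB linearZ /= [_ *: _]mulfVK ?subrr.
split=> [[uX fu0]|uX'].
  have ->: u = linfun pL u by rewrite lfunE /= /p fu0 mul0r scale0r subr0.
  have: linfun pL u \in (linfun pL @: <<map X s>>)%VS by rewrite memv_img.
  rewrite limg_span -map_comp; apply: subvP.
  apply/span_subvP => _ /mapP[w ws ->].
  rewrite [X in X \in _]lfunE /= /p; have [a _ ->] := XX' w ws.
  by rewrite memvZ // memv_span // map_f.
have sub: (<<map X' s>> <= <<map X s>> :&: lker (linfun f))%VS.
  apply/span_subvP => _ /mapP[w ws ->].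
  have [a a0 aE] := XX' w ws.
  have ->: X' w = a^-1 *: p (X w) by rewrite /p aE scalerA mulVf ?scale1r.
  rewrite memvZ // memv_cap memv_ker lfunE /= fp eqxx andbT.
  by rewrite rpredB ?memvZ ?memv_span ?map_f.
move/(subvP sub): uX'; rewrite memv_cap memv_ker lfunE => /andP[-> /eqP fu].
by [].
Qed.

(** * Soundness of the exploration *)

Section Soundness.
Variables (F : fieldType) (p : nat).
Hypotheses (pF : p \in [pchar F]) (p5 : (5 <= p)%N).
Variables (L : nat -> F) (V : vectType F) (y : nat -> V).
Variable mu : nat -> {linear V -> F^o}.
Hypothesis muE : forall i j,
  mu i (y j) = (bracket_coef i j)%:~R * L (sum_index i j).

Definition disc_zero : bool := poly_val L disc == 0.

Let b := disc_zero.

Lemma mu_comb g sup v :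
    (forall i, (g < i < 24)%N -> (i \in sup) = (L i != 0)) ->
  mu g (comb L y v) = poly_val L (row_value sup g v).
Proof.
move=> supP; rewrite /poly_val /row_value comb_foldr [X in _ + X]/comb.
rewrite big_nil addr0.
rewrite /comb linear_sum big_map big_filter /=.
rewrite [RHS]big_mkcond; apply: eq_bigr => t _ /=.
rewrite linearZ /= muE; case: ifP => [_|].
  rewrite /term_coef /= big_cons intrM [RHS]mulr1 [LHS]mulrC.
  by rewrite [RHS]mulrACA.
have [->|nz] := eqVneq (bracket_coef g t.1) 0.
  by rewrite mul0r [_ *: _]mulr0.
move=> /=; rewrite supP ?bracket_coef_gt // => /negbFE/eqP->.
by rewrite mulr0 [_ *: _]mulr0.
Qed.

Lemma poly_val_is_disc q :
  is_disc q ->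
  poly_val L q = poly_val L disc \/ poly_val L q = - poly_val L disc.
Proof.
rewrite /poly_val; have addP r : add_comb q r == [::] ->
    comb L (fun=> 1 : F^o) q = - comb L (fun=> 1 : F^o) r.
  move=> /eqP/(congr1 (comb L (fun=> 1 : F^o))); rewrite /add_comb comb_foldr.
  by rewrite [RHS]/comb big_nil => /eqP; rewrite addr_eq0 => /eqP->.
case/orP => /addP->; first by right.
by left; rewrite comb_opp opprK.
Qed.

Lemma zero_valP q : zero_val b q -> poly_val L q = 0.
Proof.
case/orP => [/nilP->|/andP[/eqP d0 /poly_val_is_disc]].
  by rewrite /poly_val /comb big_nil.
by rewrite d0 oppr0 => -[].
Qed.

Lemma unit_valP sup q : {in sup, forall j, L j != 0} ->
  unit_val b sup q -> poly_val L q != 0.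
Proof.
move=> supP; have discP: ~~ b && is_disc q -> poly_val L q != 0.
  by case/andP => nb /poly_val_is_disc[]->; rewrite ?oppr_eq0.
case: q discP => [|t [|u q]] // _ /andP[tc /allP tm].
rewrite /poly_val /comb big_seq1 [_ *: _]mulr1 mulf_neq0 //.
  exact: (small_int_neq0 pF p5 tc).
by rewrite big_seq prodf_seq_neq0; apply/allP => i _; apply/implyP => /tm/supP.
Qed.

Definition below (i : nat) (u : V) : Prop :=
  forall j, (i <= j < 24)%N -> mu j u = 0.

Definition dependent_row (i : nat) : Prop := forall u, below i.+1 u -> mu i u = 0.

Lemma belowS i u : (i < 24)%N -> below i u <-> below i.+1 u /\ mu i u = 0.
Proof.
move=> i24; split=> [ui|[ui mi] j /andP[]].
  by split=> [j /andP[ij j24]|]; apply: ui; rewrite ?(ltnW ij) ?leqnn.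
by rewrite leq_eqVlt => /predU1P[<- //|ij j24]; apply: ui; rewrite ij.
Qed.

(** By induction on g. If the row of index g vanishes on the family, the
    condition at g holds and both values of the coordinate are explored;
    otherwise the condition fails unless the coordinate is 0, and no support of
    the list may contain g. *)
Lemma check_tree_sound g sup K Ls :
    check_tree b g sup K Ls -> (g <= 24)%N ->
    {subset sup <= [pred i | L i != 0]} ->
    (forall i, (g <= i < 24)%N -> (i \in sup) = (L i != 0)) ->
    (forall u, below g u <-> u \in <<[seq comb L y v | v <- K]>>%VS) ->
  (forall i, (i < g)%N -> L i != 0 -> dependent_row i)
  <-> exists2 w, w \in Ls & forall i, (i < g)%N -> (i \in w) = (L i != 0).
Proof.
elim: g sup K Ls => [|g IHg] sup K Ls /=.
  by case: Ls => [|w Ls] // *; split=> // _; exists w; rewrite ?mem_head.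
set KV := [seq (v, _) | v <- K] => chk g24 supL supP KP.
have supP' v : mu g (comb L y v) = poly_val L (row_value sup g v) by exact: mu_comb.
have stepL (Q : nat -> Prop) : (forall i, (i < g.+1)%N -> Q i) <->
    (forall i, (i < g)%N -> Q i) /\ Q g.
  split=> [H|[H1 H2] i]; first by split=> [i ig|]; apply: H; rewrite // ltnW.
  by rewrite ltnS leq_eqVlt => /predU1P[->|/H1].
have supP0 : L g = 0 -> forall i, (g <= i < 24)%N -> (i \in sup) = (L i != 0).
  move=> Lg0 i /andP[]; rewrite leq_eqVlt => /predU1P[<- _|gi i24].
    by rewrite Lg0 eqxx; apply/negbTE/negP => /supL; rewrite inE Lg0 eqxx.
  by apply: supP; rewrite gi.
case: ifP chk => [/allP K0 /andP[chk0 chk1]|_].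
  have dg : dependent_row g.
    move=> u /KP; rewrite -(lfunE (mu g)) => uK; apply/eqP.
    rewrite -memv_ker; apply: subvP uK; apply/span_subvP => _ /mapP[v vK ->].
    rewrite memv_ker lfunE /= supP' (zero_valP (K0 (v, row_value sup g v) _)) //.
    by rewrite map_f.
  have KP' u : below g u <-> u \in <<[seq comb L y v | v <- K]>>%VS.
    by rewrite belowS // -KP; split=> [[] //|ug]; split=> //; apply: dg.
  have claim (bg : bool) sup' : bg = (L g != 0) ->
      check_tree b g sup' K [seq w <- Ls | (g \in w) == bg] ->
      {subset sup' <= [pred i | L i != 0]} ->
      (forall i, (g <= i < 24)%N -> (i \in sup') = (L i != 0)) ->
      (forall i, (i < g.+1)%N -> L i != 0 -> dependent_row i)
      <-> exists2 w, w \in Ls & forall i, (i < g.+1)%N -> (i \in w) = (L i != 0).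
    move=> bgE chk' sL sP.
    have {}IHg := IHg _ _ _ chk' (ltnW g24) sL sP KP'.
    rewrite stepL; split=> [[/IHg[w]]|[w wLs /stepL[wg gw]]].
      rewrite mem_filter => /andP[/eqP gw wLs] wg _.
      by exists w => //; apply/stepL; rewrite -bgE.
    split=> //; apply/IHg; exists w => //.
    by rewrite mem_filter wLs gw bgE eqxx.
  have [Lg0|Lg] := eqVneq (L g) 0.
    apply: (claim false sup); rewrite ?Lg0 ?eqxx //.
      by under eq_filter do rewrite eqbF_neg.
    exact: supP0.
  apply: (claim true (g :: sup)) => //.
  - by under eq_filter do rewrite eqb_id.
  - by move=> i; rewrite inE => /predU1P[->|/supL].
  move=> i /andP[]; rewrite leq_eqVlt inE => /predU1P[<- _|gi i24].
    by rewrite eqxx Lg.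
  by rewrite (gtn_eqF gi); apply: supP; rewrite gi.
case piv: [seq _ <- KV | _] => [|[v q] r] // /andP[/allP gLs chk].
have: (v, q) \in [seq p <- KV | unit_val b sup p.2] by rewrite piv mem_head.
rewrite mem_filter => /andP[/= uq /mapP[v' vK [? qE]]]; subst v'.
have muv : mu g (comb L y v) != 0 by rewrite supP' -qE (unit_valP _ uq).
have Ndg : ~ dependent_row g.
  by move=> dg; case/eqP: muv; apply/dg/KP; rewrite memv_span ?map_f.
have [Lg0|Lg] := eqVneq (L g) 0; last first.
  rewrite stepL; split=> [[_ /(_ Lg)]//|[w wLs /stepL[_]]].
  by rewrite Lg (negbTE (gLs _ wLs)).
(* One step of elimination with pivot v, up to units. *)
set K' := map _ _ in chk.
suff KP' u : below g u <-> u \in <<[seq comb L y w | w <- K']>>%VS.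
  have {}IHg := IHg _ _ _ chk (ltnW g24) supL (supP0 Lg0) KP'.
  rewrite stepL; split=> [[/IHg[w wLs wg] _]|[w wLs /stepL[wg _]]].
    exists w => //; apply/stepL; split=> //.
    by rewrite Lg0 eqxx (negbTE (gLs _ wLs)).
  by split; [apply/IHg; exists w|rewrite Lg0 eqxx].
rewrite belowS // KP.
have supnz : {in sup, forall j, L j != 0} by move=> j /supL.
pose step (w : seq term) := let r := row_value sup g w in
  if zero_val b r then w else
  strip sup (add_comb (scale_comb q w) (scale_comb (opp_comb r) v)).
have stepP w : exists2 a, a != 0 &
    comb L y w - (mu g (comb L y w) / mu g (comb L y v)) *: comb L y v
    = a *: comb L y (step w).
  rewrite /step supP' [mu g (comb L y v)]supP' -qE; case: ifP => [/zero_valP->|_].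
    by exists 1; rewrite ?oner_neq0 // mul0r scale0r subr0 scale1r.
  set c := add_comb _ _; have [a nz_a cE] := comb_strip y c supnz.
  exists ((poly_val L q)^-1 * a).
    by rewrite mulf_neq0 // invr_neq0 // qE -supP'.
  rewrite -[RHS]scalerA -cE /c /add_comb comb_foldr !comb_scale.
  rewrite /(poly_val L (opp_comb _)) comb_opp scaleNr scalerBr !scalerA.
  by rewrite mulVf ?scale1r 1?mulrC // qE -supP'.
have ->: [seq comb L y w | w <- K'] = [seq comb L y (step w) | w <- K].
  by rewrite /K' /KV -!map_comp.
apply: (span_elim (X := comb L y) (X' := fun w => comb L y (step w)) vK muv).
by move=> w _; apply: stepP.
Qed.

End Soundness.

(** * The set S *)

(** The two explorations of the tree. *)
Lemma check_tree_supports b :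
  check_tree b 24 [::] std_basis [seq positions w | w <- supports b].
Proof. by case: b; vm_compute. Qed.

Lemma supports_pos :
  all (all (mem pos_roots)) (list_L ++ exceptional_supports).
Proof. by vm_compute. Qed.

Section SupportsOfS.
Variables (F : fieldType) (p : nat).
Hypotheses (pF : p \in [pchar F]) (p5 : (5 <= p)%N).
Variables (g : lieType F) (n : {vspace g}) (e : weight -> g).
Variable lam : 'Hom(subvs_of n, F^o).
Variable t : nat -> F.
Hypothesis t_neq0 : forall k, t k != 0.
Hypothesis t_bracket : forall i j, (i < 24)%N -> (j < 24)%N ->
  bracket_holds e t (i, j).

Let L (i : nat) : F := form_at lam (rescaled e t i).

Lemma form_atZ a u : form_at lam (a *: u) = a * form_at lam u.
Proof. by rewrite /form_at !linearZ. Qed.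

Lemma mem_supp i : (i < 24)%N -> (pos_root i \in supp e lam) = (L i != 0).
Proof.
move=> i24; rewrite mem_filter pos_root_mem // andbT /L form_atZ.
by rewrite mulf_eq0 (negbTE (t_neq0 i)).
Qed.

Definition coord_vec (j : nat) : 'cV[F]_24 := \col_k (k == j :> nat)%:R.

Definition form_row (i : nat) : 'rV[F]_24 :=
  \row_k ((bracket_coef i k)%:~R * L (sum_index i k)).

Definition row_fun (i : nat) (u : 'cV[F]_24) : F^o := (form_row i *m u) 0 0.

Lemma row_fun_linear i : linear (row_fun i).
Proof. by move=> a u v; rewrite /row_fun mulmxDr -scalemxAr !mxE. Qed.

HB.instance Definition _ i :=
  GRing.isLinear.Build F _ _ _ (row_fun i) (row_fun_linear i).

Lemma row_fun_coord i j :
  row_fun i (coord_vec j) = (bracket_coef i j)%:~R * L (sum_index i j).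
Proof.
rewrite /row_fun mxE; have [j24|j24] := ltnP j 24.
  rewrite (bigD1 (Ordinal j24)) //= big1 => [|k kj]; rewrite !mxE.
    by rewrite eqxx mulr1 addr0.
  rewrite (_ : (k == j :> nat) = false) ?mulr0 //.
  by apply: contraNF kj => /eqP kj; apply/eqP/val_inj.
rewrite big1 => [|k _]; last first.
  by rewrite !mxE (ltn_eqF (leq_trans (ltn_ord k) j24)) mulr0.
have [->|/bracket_coef_supp[_]] := eqVneq (bracket_coef i j) 0.
  by rewrite mul0r.
by rewrite ltnNge j24.
Qed.

(** Passing from e to the rescaled basis multiplies the j-th row of the bracket
    matrix by t j, and its columns are rescaled along with the coordinates of
    the vectors of the kernel. *)
Lemma in_S_dependent : in_S e lam <->
  forall i, (i < 24)%N -> L i != 0 -> dependent_row (fun i => row_fun i) i.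
Proof.
have sumE j (u : 'cV[F]_24) : (j < 24)%N ->
    \sum_(k < 24) form_at lam (lie (e (pos_root j)) (e (pos_root k))) * u k 0
    = (t j)^-1 * row_fun j (\col_k ((t k)^-1 * u k 0)).
  move=> j24; rewrite /row_fun mxE mulr_sumr; apply: eq_bigr => k _; rewrite !mxE.
  have := t_bracket j24 (ltn_ord k); rewrite /bracket_holds /rescaled /=.
  rewrite lieZl linearZ /= => /(congr1 (form_at lam)).
  rewrite /L /rescaled !form_atZ => <-.
  rewrite !mulrA mulVf // mul1r; congr (_ * _).
  by rewrite mulrAC mulfV // mul1r.
have depE i : (i < 24)%N ->
    \rank (A_mx e lam (pos_root i)) = \rank (B_mx e lam (pos_root i))
    <-> dependent_row (fun i => row_fun i) i.
  move=> i24; apply: iff_trans (rank_bracket_matrix e lam i24) _.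
  split=> dep u uP.
    have := dep (\col_k (t k * u k 0)).
    have uE : (\col_k ((t k)^-1 * (\col_k (t k * u k 0)) k 0)) = u :> 'cV_24.
      by apply/matrixP => k l; rewrite !mxE ord1 mulrA mulVf ?mul1r.
    rewrite sumE // uE => H.
    have /eqP : (t i)^-1 * row_fun i u = 0.
      by apply: H => j /andP[ij j24]; rewrite sumE // uE uP ?mulr0 ?ij.
    by rewrite mulf_eq0 invr_eq0 (negbTE (t_neq0 i)) => /eqP.
  rewrite sumE // dep ?mulr0 // => j /andP[ij j24].
  have /eqP : (t j)^-1 * row_fun j (\col_k ((t k)^-1 * u k 0)) = 0.
    by rewrite -sumE // uP ?ij.
  by rewrite mulf_eq0 invr_eq0 (negbTE (t_neq0 j)) => /eqP.
split=> [S i i24 Li|dep c cS].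
  by apply/depE => //; apply: S; rewrite mem_supp.
have cP : c \in pos_roots by move: cS; rewrite mem_filter => /andP[].
have i24 : (index c pos_roots < 24)%N.
  by rewrite -[24%N]/(size pos_roots) index_mem.
have cE : c = pos_root (index c pos_roots) by rewrite /pos_root nth_index.
by rewrite cE; apply/depE/dep => //; rewrite -mem_supp // -cE.
Qed.

Lemma coord_vec_span u : u \in <<[seq comb L coord_vec v | v <- std_basis]>>%VS.
Proof.
have ->: u = \sum_(k < 24) u k 0 *: coord_vec k.
  apply/matrixP => i j; rewrite ord1 summxE (bigD1 i) //= big1 => [|k ki].
    by rewrite !mxE eqxx mulr1 addr0.
  rewrite !mxE (_ : (i == k :> nat) = false) ?mulr0 //.
  by apply: contraNF ki => /eqP ki; apply/eqP/val_inj.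
apply: memv_suml => k _; apply: memvZ; apply: memv_span.
apply/mapP; exists (unit_vec k); first by rewrite map_f // mem_iota ltn_ord.
by rewrite /comb big_seq1 /term_coef /= big_nil mulr1 scale1r.
Qed.

Lemma in_S_supports : in_S e lam <->
  exists2 w, w \in supports (disc_zero L) & supp e lam =i w.
Proof.
have Ls_pos w : w \in supports (disc_zero L) -> all (mem pos_roots) w.
  move=> wLs; apply: (allP supports_pos); move: wLs; rewrite /supports.
  by case: ifP => // _; rewrite (mem_cat w list_L exceptional_supports) => ->.
apply: iff_trans in_S_dependent _.
have chk := check_tree_supports (disc_zero L).
apply: iff_trans (check_tree_sound pF p5 row_fun_coord chk _ _ _ _) _ => //.
- by move=> i; rewrite leqNgt; case: ltnP.
- move=> u; split=> [_|_ j /andP[]]; first exact: coord_vec_span.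
  by rewrite leqNgt; case: ltnP.
have wE w : all (mem pos_roots) w ->
    (forall i, (i < 24)%N -> (i \in positions w) = (L i != 0))
    <-> supp e lam =i w.
  move=> /allP wpos.
  have rE i : (i < 24)%N -> (i \in positions w) = (pos_root i \in w).
    move=> i24; apply/mapP/idP => [[a aw ->]|iw].
      by rewrite /pos_root nth_index //; exact: wpos.
    by exists (pos_root i); rewrite // index_uniq.
  split=> [H a|H i i24]; last by rewrite rE // -mem_supp // H.
  have [aP|aP] := boolP (a \in pos_roots); last first.
    rewrite mem_filter (negbTE aP) andbF; apply/esym/negbTE.
    by apply: contra aP => /wpos.
  have i24 : (index a pos_roots < 24)%N.
    by rewrite -[24%N]/(size pos_roots) index_mem.
  by have := H _ i24; rewrite rE // -mem_supp // /pos_root nth_index.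
split=> [[_ /mapP[w wLs ->] /wE wS]|[w wLs /wE wS]].
  by exists w => //; apply/wS/Ls_pos.
by exists (positions w); [apply: map_f|apply/wS/Ls_pos].
Qed.

End SupportsOfS.

Theorem proposition2p1 :
  exists p0 : nat,
  forall (F : finFieldType) (p : nat), p \in [pchar F] -> (p0 <= p)%N ->
  forall (g : lieType F) (h : 'I_4 -> g) (x : weight -> g),
    chevalley_basis h x ->
  forall n : {vspace g}, nilradical (borel h x) n ->
  forall e : weight -> g,
    (forall a, a \in pos_roots -> root_vector h a (e a)) -> normalized e ->
  forall lam : 'Hom(subvs_of n, F^o),
    in_S e lam <->
    (exists2 w, w \in list_L & supp e lam =i w)
    \/ (exists2 w, w \in exceptional_supports & supp e lam =i w)
       /\ form_at lam (e (alpha1 + alpha2))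
            * form_at lam (e (alpha2 + alpha3 *+ 2 + alpha4)) ^+ 2
          = form_at lam (e (alpha1 + alpha2 + alpha3 *+ 2))
            * form_at lam (e (alpha2 + alpha3 + alpha4)) ^+ 2.
Proof.
exists 5 => F p pF p5 g h x hx n _ e eP norm lam.
have e_neq0 a : a \in pos_roots -> e a != 0 by case/eP.
have e_lie := lie_root_vectors pF p5 hx eP.
have [t [t0 tP t1]] := normal_form pF p5 e_neq0 e_lie norm.
have LE k : k \in positions (word "fhkn") ->
    form_at lam (rescaled e t k) = form_at lam (e (pos_root k)).
  by move=> kf; rewrite /rescaled t1 // scale1r.
have discE : disc_zero (fun i => form_at lam (rescaled e t i)) =
    (form_at lam (e (alpha1 + alpha2))
       * form_at lam (e (alpha2 + alpha3 *+ 2 + alpha4)) ^+ 2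
     == form_at lam (e (alpha1 + alpha2 + alpha3 *+ 2))
       * form_at lam (e (alpha2 + alpha3 + alpha4)) ^+ 2).
  rewrite /disc_zero /poly_val /comb big_cons big_seq1 /term_coef /=.
  rewrite !big_cons !big_nil !LE //.
  (* 5, 7, 10, 13 are the indices of the roots f, h, k, n. *)
  rewrite -[pos_root 10]/(alpha1 + alpha2).
  rewrite -[pos_root 7]/(alpha2 + alpha3 *+ 2 + alpha4).
  rewrite -[pos_root 13]/(alpha1 + alpha2 + alpha3 *+ 2).
  rewrite -[pos_root 5]/(alpha2 + alpha3 + alpha4).
  by rewrite mulrN1z mulN1r mul1r ![_ *: 1]mulr1 !mulr1 subr_eq0 -!expr2.
have supE b w : w \in supports b =
    (w \in list_L) || b && (w \in exceptional_supports).
  by case: b; [apply: mem_cat|rewrite orbF].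
have := in_S_supports pF p5 lam t0 tP; rewrite discE => S.
split=> [/S[w]|wS].
  rewrite supE => /orP[wL|/andP[/eqP E wX]] wE; first by left; exists w.
  by right; split; [exists w|apply: E].
apply/S; case: wS => [[w wL wE]|[[w wX wE] /eqP E]]; exists w; rewrite ?supE //.
  by rewrite wL.
by rewrite E wX orbT.
Qed.
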